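(* Let $X$ be a metric space, let $M(X)$ be either $M^q(X)$ or $M^c(X)$, and let $L(X)$ be the corresponding Boolean algebra generated by the distributive lattice $E(M(X))$. The set $\widehat X$ of Boolean homomorphisms from $L(X)$ to the two-element Boolean algebra $\mathbb Z/2$ is canonically isomorphic to the set $\mathrm{Hom}(E(M(X)),\mathbb Z/2)$ of unital lattice homomorphisms from $E(M(X))$ to $\mathbb Z/2$ (i.e. lattice homomorphisms preserving $\mathbf 0$ and $\mathbf 1$): the map $\psi\mapsto\psi|_{E(M(X))}$ is a bijection $\widehat X\to\mathrm{Hom}(E(M(X)),\mathbb Z/2)$.
   Context: Let $(X,d_X)$ be a metric space. Write $x$ for $(x,0)$ and $x'$ for $(x,1)$ in $X\times\{0,1\}$. $\mathcal M(X)$ is the set of all metrics $d$ on $X\times\{0,1\}$ whose restriction to each copy of $X$ equals $d_X$ and with $\inf_{x,y\in X}d(x,y')>0$. Metrics $d_1,d_2$ are quasi-equivalent if there exist $\alpha>0,\beta\ge1$ with $-\alpha+\frac1\beta d_1(x,y')\le d_2(x,y')\le\alpha+\beta d_1(x,y')$ for all $x,y$; they are coarse equivalent if there are monotone $\varphi,\psi:[0,\infty)\to[0,\infty)$ tending to $\infty$ at $\infty$ with $\varphi(d_1(x,y'))\le d_2(x,y')\le\psi(d_1(x,y'))$ for all $x,y$. $M^q(X)$, resp. $M^c(X)$, is the set of quasi-equivalence, resp. coarse equivalence, classes; both are inverse semigroups under $[\rho][d]=[\rho d]$, $(\rho d)(x,y')=\inf_{z\in X}[d(x,z')+\rho(z,y')]$.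 $E(M(X))$ is the set of idempotents; each idempotent class has a selfadjoint representative ($d(x,y')=d(y,x')$) and is determined by the class of the function $x\mapsto d(x,x')$ under the corresponding (quasi- or coarse) equivalence of functions. $E(M(X))$ is a distributive lattice: for $p=[d_1]$, $q=[d_2]$ with $d_i$ selfadjoint, $p\land q$ (which equals $pq$) and $p\lor q$ are the idempotents whose functions are equivalent to $x\mapsto\max(d_1(x,x'),d_2(x,x'))$ and $x\mapsto\min(d_1(x,x'),d_2(x,x'))$, respectively. Its minimal element $\mathbf 0$ is the class of $d_X(x,x_0)+1+d_X(x_0,y)$ (any $x_0\in X$), and its maximal element $\mathbf 1$ is the unit of $M(X)$, represented by $d_X(x,y)+1$. $H(X)$ is the set of all finite formal sums $e_1+\cdots+e_n$ with $e_i\in E(M(X))\setminus\{\mathbf 0\}$, with summation mod 2 ($e+e=0$), and with the product $\land$ extended from $E(M(X))$ by linearity ($\mathbf 0$ being identified with the empty sum). $I$ is the ideal in $H(X)$ generated by all $e+f+e\land f+e\lor f$, $e,f\in E(M(X))$. $L(X)=H(X)/I$ is a Boolean algebra with complement $\overline e=\mathbf 1+e$, and it contains $E(M(X))$ as a sublattice. *)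

(* Defs.v *)
From HB Require Import structures.
From mathcomp Require Import all_boot all_order all_algebra finmap lra.
From mathcomp Require Import all_classical all_reals all_analysis.

Set Implicit Arguments.
Unset Strict Implicit.
Unset Printing Implicit Defensive.

Import Order.TTheory GRing.Theory Num.Theory.
Import numFieldTopology.Exports.

Local Open Scope classical_set_scope.
Local Open Scope quotient_scope.
Local Open Scope ring_scope.

Inductive equivalence_kind := Quasi | Coarse.

Section FunctionEquivalence.
Context {R : realType}.

Definition quasi_equiv (T : Type) (f g : T -> R) : Prop :=
  exists a b : R, [/\ 0 < a, 1 <= b &
    forall t, - a + b^-1 * f t <= g t <= a + b * f t].

(* A function [0, +oo[ -> [0, +oo[ is a function R -> R of which only the
   values on [0, +oo[ matter. *)
Definition control (phi : R -> R) : Prop :=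
  [/\ forall t, 0 <= t -> 0 <= phi t,
      forall s t, 0 <= s -> s <= t -> phi s <= phi t &
      phi t @[t --> +oo] --> +oo].

Definition coarse_equiv (T : Type) (f g : T -> R) : Prop :=
  exists phi psi : R -> R, [/\ control phi, control psi &
    forall t, phi (f t) <= g t <= psi (f t)].

Definition fun_equiv (k : equivalence_kind) : forall T, (T -> R) -> (T -> R) -> Prop :=
  match k with Quasi => quasi_equiv | Coarse => coarse_equiv end.

(* f is dominated by g when it is at most an affine, respectively any
   nondecreasing, function of g; fun_equivP relates this to fun_equiv. *)
Section Domination.
Context (k : equivalence_kind).

Definition bounding (psi : R -> R) : Prop :=
  match k with
  | Quasi => exists a b, [/\ 0 <= a, 0 <= b & forall t, psi t = a + b * t]
  | Coarse => (forall t, 0 <= t -> 0 <= psi t) /\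
              (forall s t, 0 <= s -> s <= t -> psi s <= psi t)
  end.

Lemma bounding_ge0 psi : bounding psi -> forall t, 0 <= t -> 0 <= psi t.
Proof.
rewrite /bounding; case: k => [[a [b [a0 b0 E]]] t t0|[]//].
by rewrite E addr_ge0// mulr_ge0.
Qed.

Lemma bounding_nd psi : bounding psi ->
  forall s t, 0 <= s -> s <= t -> psi s <= psi t.
Proof.
rewrite /bounding; case: k => [[a [b [a0 b0 E]]] s t s0 st|[]//].
by rewrite !E lerD2l ler_wpM2l.
Qed.

Lemma bounding_id : bounding id.
Proof.
rewrite /bounding; case: k; last by split.
by exists 0, 1; split=> // t; rewrite add0r mul1r.
Qed.

Lemma bounding_cst c : 0 <= c -> bounding (fun=> c).
Proof.
rewrite /bounding => c0; case: k; last by split.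
by exists c, 0; split=> // t; rewrite mul0r addr0.
Qed.

Lemma bounding_add psi chi : bounding psi -> bounding chi ->
  bounding (fun t => psi t + chi t).
Proof.
rewrite /bounding; case: k.
  move=> [a [b [a0 b0 E]]] [a' [b' [a'0 b'0 E']]].
  exists (a + a'), (b + b'); split; rewrite ?addr_ge0// => t.
  by rewrite E E' mulrDl addrACA.
move=> [p0 pn] [c0 cn]; split=> [t t0|s t s0 st]; first by rewrite addr_ge0 ?p0 ?c0.
by rewrite lerD ?pn ?cn.
Qed.

Lemma bounding_comp psi chi : bounding psi -> bounding chi ->
  bounding (fun t => psi (chi t)).
Proof.
rewrite /bounding; case: k.
  move=> [a [b [a0 b0 E]]] [a' [b' [a'0 b'0 E']]].
  exists (a + b * a'), (b * b'); split; rewrite ?addr_ge0 ?mulr_ge0// => t.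
  by rewrite E E' mulrDr addrA mulrA.
move=> [p0 pn] [c0 cn]; split=> [t t0|s t s0 st]; first by rewrite p0 ?c0.
by rewrite pn ?cn ?c0.
Qed.

Lemma bounding_shift psi : bounding psi -> bounding (fun t => psi (t + 1)).
Proof.
move=> hpsi; apply: (bounding_comp hpsi (chi := fun t => t + 1)).
by apply: (bounding_add (psi := id)); [exact: bounding_id|exact: bounding_cst].
Qed.

Definition dom (T : Type) (f g : T -> R) : Prop :=
  exists2 psi, bounding psi & forall t, f t <= psi (g t).

Lemma domW (T : Type) (f g : T -> R) : (forall t, f t <= g t) -> dom f g.
Proof. by move=> fg; exists id => //; exact: bounding_id. Qed.

Lemma dom_trans (T : Type) (g f h : T -> R) : (forall t, 0 <= g t) ->
  dom f g -> dom g h -> dom f h.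
Proof.
move=> g0 [psi bpsi fg] [chi bchi gh].
exists (fun t => psi (chi t)); first exact: bounding_comp.
by move=> t; rewrite (le_trans (fg t))// (bounding_nd bpsi).
Qed.

Lemma dom_add (T : Type) (f f' g : T -> R) : dom f g -> dom f' g ->
  dom (fun t => f t + f' t) g.
Proof.
move=> [psi bpsi fg] [chi bchi f'g].
exists (fun t => psi t + chi t); first exact: bounding_add.
by move=> t; rewrite lerD.
Qed.

End Domination.

Lemma fun_equivP k (T : Type) (f g : T -> R) :
  (forall t, 0 <= f t) -> (forall t, 0 <= g t) ->
  fun_equiv k f g <-> dom k f g /\ dom k g f.
Proof.
move=> f0 g0; case: k => /=; split.
- move=> [a [b [a0 b1 H]]]; split.
    exists (fun t => b * a + b * t).
      by exists (b * a), b; split => //; rewrite ?mulr_ge0//; lra.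
    move=> t; have /andP[h _] := H t.
    have b0 : 0 < b by lra.
    by rewrite -mulrDr -ler_pdivrMl//; lra.
  exists (fun t => a + b * t); first by exists a, b; split=> //; lra.
  by move=> t; have /andP[] := H t.
- move=> [[psi [a [b [a0 b0 E]] fg]] [chi [a' [b' [a'0 b'0 E']] gf]]].
  exists (a + a' + 1), (b + b' + 1); split; [lra|lra|move=> t].
  have B0 : 0 < b + b' + 1 by lra.
  have := fg t; rewrite E => fgt; have := gf t; rewrite E' => gft.
  have ft := f0 t; have gt := g0 t.
  apply/andP; split; last by nra.
  rewrite addrC lerBlDr ler_pdivrMl//; nra.
- move=> [phi [psi [[p0 pn poo] [q0 qn qoo] H]]]; split; last first.
    by exists psi => // t; have /andP[] := H t.
  have S_ub t : has_ubound [set s | 0 <= s /\ phi s <= t].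
    have [A [_ HA]] : \forall s \near +oo, t + 1 <= phi s.
      by move/cvgryPge : poo => /(_ (t + 1)).
    exists (Num.max A 0 + 1) => s [s0 ps]; rewrite leNgt; apply/negP => As.
    have : t + 1 <= phi s by apply: HA; move: As; rewrite maxEle; case: ifP; lra.
    by lra.
  exists (fun t => sup [set s | 0 <= s /\ phi s <= t]).
    split=> [t t0|s t s0 st].
      have [->|/set0P[s Ss]] := eqVneq [set s | 0 <= s /\ phi s <= t] set0.
        by rewrite sup0.
      by apply: (@le_trans _ _ s); [case: Ss|exact: ub_le_sup].
    have [->|/set0P[u Su]] := eqVneq [set u | 0 <= u /\ phi u <= s] set0.
      rewrite sup0; have [->|/set0P[u Su]] := eqVneq [set u | 0 <= u /\ phi u <= t] set0.
        by rewrite sup0.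
      by apply: (@le_trans _ _ u); [case: Su|exact: ub_le_sup].
    apply: ge_sup; first by exists u.
    move=> v [v0 vs]; apply: ub_le_sup => //; split => //; exact: le_trans st.
  move=> t; apply: ub_le_sup => //; split; first exact: f0.
  by have /andP[] := H t.
- move=> [[chi [c0 cn] fg] [psi [p0 pn] gf]].
  pose S s := [set t | 0 <= t /\ s <= chi t + t].
  have S_lb s : lbound (S s) 0 by move=> t [].
  have S_ne s : 0 <= s -> S s !=set0.
    by move=> s0; exists s; split => //; rewrite lerDr c0.
  exists (fun s => inf (S s)), (fun t => psi t + t); split.
  + split=> [s s0|s t s0 st|].
    * by apply: lb_le_inf; [exact: S_ne|exact: S_lb].
    * apply: lb_le_inf; first by apply: S_ne; lra.
      move=> v [v0 tv]; apply: ge_inf; first by exists 0; exact: S_lb.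
      by split=> //; lra.
    * apply/cvgryPge => A; near=> s.
      have s0 : 0 <= s by near: s; exact: nbhs_pinfty_ge (num_real _).
      apply: lb_le_inf; first exact: S_ne.
      move=> v [v0 sv]; rewrite leNgt; apply/negP => vA.
      have cvA : chi v <= chi A by apply: cn => //; lra.
      have : chi A + A <= s by near: s; exact: nbhs_pinfty_ge (num_real _).
      by lra.
  + split=> [t t0|s t s0 st|]; first by rewrite addr_ge0 ?p0.
      by rewrite lerD ?pn.
    apply/cvgryPge => A; near=> s.
    have s0 : 0 <= s by near: s; exact: nbhs_pinfty_ge (num_real _).
    have As : A <= s by near: s; exact: nbhs_pinfty_ge (num_real _).
    by have := p0 _ s0; lra.
  + move=> t; apply/andP; split; last by have := gf t; have := f0 t; lra.
    apply: ge_inf; first by exists 0; exact: S_lb.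
    by split=> //; have := fg t; have := g0 t; lra.
Unshelve. all: by end_near.
Qed.

Definition sim k (T : Type) (f g : T -> R) : Prop :=
  [/\ forall t, 0 <= f t, forall t, 0 <= g t, dom k f g & dom k g f].

Lemma sim_refl k (T : Type) (f : T -> R) : (forall t, 0 <= f t) -> sim k f f.
Proof. by move=> f0; split=> //; exact: domW. Qed.

Lemma sim_sym k (T : Type) (f g : T -> R) : sim k f g -> sim k g f.
Proof. by case. Qed.

Lemma sim_trans k (T : Type) (g f h : T -> R) : sim k f g -> sim k g h -> sim k f h.
Proof. by case=> f0 g0 fg gf [_ h0 gh hg]; split=> //; exact: (@dom_trans _ _ g). Qed.

Lemma dom_max k (T : Type) (f f' g g' : T -> R) :
  (forall t, 0 <= f' t) -> (forall t, 0 <= g' t) ->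
  dom k f f' -> dom k g g' ->
  dom k (fun t => Num.max (f t) (g t)) (fun t => Num.max (f' t) (g' t)).
Proof.
move=> f0 g0 [psi bpsi H] [chi bchi H'].
exists (fun t => psi t + chi t); first exact: bounding_add.
move=> t; set m := Num.max (f' t) (g' t).
have fm : f' t <= m by rewrite le_max lexx.
have gm : g' t <= m by rewrite le_max lexx orbT.
have := bounding_nd bpsi (f0 t) fm; have := bounding_nd bchi (g0 t) gm.
have := bounding_ge0 bpsi (le_trans (f0 t) fm).
have := bounding_ge0 bchi (le_trans (f0 t) fm).
have := H t; have := H' t; rewrite ge_max; lra.
Qed.

Lemma dom_min k (T : Type) (f f' g g' : T -> R) :
  (forall t, 0 <= f' t) -> (forall t, 0 <= g' t) ->
  dom k f f' -> dom k g g' ->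
  dom k (fun t => Num.min (f t) (g t)) (fun t => Num.min (f' t) (g' t)).
Proof.
move=> f0 g0 [psi bpsi H] [chi bchi H'].
exists (fun t => psi t + chi t); first exact: bounding_add.
move=> t; have := H t; have := H' t.
have := bounding_ge0 bpsi (f0 t); have := bounding_ge0 bchi (f0 t).
have := bounding_ge0 bpsi (g0 t); have := bounding_ge0 bchi (g0 t).
by rewrite ge_min; case: (leP (f' t) (g' t)) => _; lra.
Qed.

Lemma sim_max k (T : Type) (f f' g g' : T -> R) : sim k f f' -> sim k g g' ->
  sim k (fun t => Num.max (f t) (g t)) (fun t => Num.max (f' t) (g' t)).
Proof.
case=> f0 f'0 ff' f'f [g0 g'0 gg' g'g].
by split; [move=> t; rewrite le_max f0|move=> t; rewrite le_max f'0|
           exact: dom_max|exact: dom_max].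
Qed.

Lemma sim_min k (T : Type) (f f' g g' : T -> R) : sim k f f' -> sim k g g' ->
  sim k (fun t => Num.min (f t) (g t)) (fun t => Num.min (f' t) (g' t)).
Proof.
case=> f0 f'0 ff' f'f [g0 g'0 gg' g'g].
by split; [move=> t; rewrite le_min f0 g0|move=> t; rewrite le_min f'0 g'0|
           exact: dom_min|exact: dom_min].
Qed.

End FunctionEquivalence.

(* The double X x {0,1} is X * bool, with x = (x, false) and x' = (x, true).
   The infimum is taken in the extended reals so that it is +oo when X is
   empty. *)
Record double_metric (R : realType) (X : metricType R) := DoubleMetric {
  dbl :> X * bool -> X * bool -> R;
  dbl_eq0 : forall p q, dbl p q = 0 <-> p = q;
  dbl_sym : forall p q, dbl p q = dbl q p;
  dbl_triangle : forall p q r, dbl p r <= dbl p q + dbl q r;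
  dbl_restrict : forall i x y, dbl (x, i) (y, i) = mdist x y;
  dbl_inf_gt0 :
    (0 < ereal_inf [set (dbl (p.1, false) (p.2, true))%:E | p in [set: X * X]])%E
}.

HB.instance Definition _ (R : realType) (X : metricType R) :=
  gen_eqMixin (double_metric X).
HB.instance Definition _ (R : realType) (X : metricType R) :=
  gen_choiceMixin (double_metric X).

Section DoubleMetrics.
Context {R : realType} {X : metricType R}.
Implicit Types (d rho : double_metric X) (x y z : X).

(* d(x, y') *)
Definition cross d x y : R := d (x, false) (y, true).

(* d(x, x') *)
Definition diag d x : R := cross d x x.

Lemma dbl_ge0 d p q : 0 <= d p q.
Proof.
have := dbl_triangle d p q p; rewrite (dbl_sym d q p).
have -> : d p p = 0 by apply/dbl_eq0.
lra.
Qed.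

Lemma cross_ge0 d x y : 0 <= cross d x y. Proof. exact: dbl_ge0. Qed.

Lemma diag_ge0 d x : 0 <= diag d x. Proof. exact: cross_ge0. Qed.

Lemma cross_tril d x y z : cross d x y <= mdist x z + cross d z y.
Proof. by rewrite -(dbl_restrict d false); exact: dbl_triangle. Qed.

Lemma cross_trir d x y z : cross d x y <= cross d x z + mdist z y.
Proof. by rewrite -(dbl_restrict d true); exact: dbl_triangle. Qed.

Lemma cross_distl d x y z : mdist x y <= cross d x z + cross d y z.
Proof.
rewrite -(dbl_restrict d false) /cross (dbl_sym d (y, false)).
exact: dbl_triangle.
Qed.

Lemma cross_distr d x y z : mdist x y <= cross d z x + cross d z y.
Proof.
rewrite -(dbl_restrict d true) /cross (dbl_sym d _ (x, true)).
exact: dbl_triangle.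
Qed.

Lemma cross_inf d : exists2 c : R, 0 < c & forall x y, c <= cross d x y.
Proof.
have := dbl_inf_gt0 d; set S := (X in ereal_inf X) => S0.
have lbS x y : (ereal_inf S <= (cross d x y)%:E)%E.
  by apply: ereal_inf_lbound; exists (x, y).
move: S0 lbS; case: (ereal_inf S) => [c| |] //.
  by rewrite lte_fin => c0 H; exists c => // x y; rewrite -lee_fin.
by move=> _ H; exists 1 => // x y; have := H x y.
Qed.

(* The metric on the double extending d_X on both copies, with d(x, y') = D x y *)
Definition glue_fun (D : X -> X -> R) (p q : X * bool) : R :=
  match p, q with
  | (x, false), (y, false) | (x, true), (y, true) => mdist x y
  | (x, false), (y, true) | (y, true), (x, false) => D x y
  end.

Record glueable (D : X -> X -> R) : Prop := Glueable {
  glue_tril : forall x y z, D x y <= mdist x z + D z y;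
  glue_trir : forall x y z, D x y <= D x z + mdist z y;
  glue_distl : forall x y z, mdist x y <= D x z + D y z;
  glue_distr : forall x y z, mdist x y <= D z x + D z y;
  glue_inf : exists2 c : R, 0 < c & forall x y, c <= D x y
}.

Section Glue.
Context (D : X -> X -> R) (hD : glueable D).

Lemma glue_eq0 p q : glue_fun D p q = 0 <-> p = q.
Proof.
have [c c0 cD] := glue_inf hD.
case: p q => [x []] [y []] /=; split=> [|[]]//.
- by move/mdist_positivity ->.
- by move=> ->; rewrite mdistxx.
- by move=> h; have := cD y x; rewrite h leNgt c0.
- by move=> h; have := cD x y; rewrite h leNgt c0.
- by move/mdist_positivity ->.
- by move=> ->; rewrite mdistxx.
Qed.

Lemma glue_sym p q : glue_fun D p q = glue_fun D q p.
Proof. by case: p q => [x []] [y []] //=; exact: metric_sym. Qed.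

Lemma glue_triangle p q r : glue_fun D p r <= glue_fun D p q + glue_fun D q r.
Proof.
case: p q r => [x []] [y []] [z []] /=.
- exact: metric_triangle.
- by rewrite addrC [mdist x y]metric_sym; exact: glue_trir.
- exact: glue_distr.
- by rewrite addrC [mdist y z]metric_sym; exact: glue_tril.
- exact: glue_trir.
- exact: glue_distl.
- exact: glue_tril.
- exact: metric_triangle.
Qed.

Lemma glue_restrict i x y : glue_fun D (x, i) (y, i) = mdist x y.
Proof. by case: i. Qed.

Lemma glue_inf_gt0 :
  (0 < ereal_inf [set (glue_fun D (p.1, false) (p.2, true))%:E
                 | p in [set: X * X]])%E.
Proof.
have [c c0 cD] := glue_inf hD.
apply: (@lt_le_trans _ _ c%:E); first by rewrite lte_fin.
by apply: le_ereal_inf_tmp => _ [p _ <-]; rewrite lee_fin /=; exact: cD.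
Qed.

Definition glue : double_metric X :=
  DoubleMetric glue_eq0 glue_sym glue_triangle glue_restrict glue_inf_gt0.

End Glue.

(* (rho d)(x, y') *)
Definition comp_cross rho d x y : R :=
  inf [set cross d x z + cross rho z y | z in [set: X]].

Lemma comp_cross_le rho d x y z : comp_cross rho d x y <= cross d x z + cross rho z y.
Proof.
apply: ge_inf; last by exists z.
by exists 0 => _ [w _ <-]; rewrite addr_ge0 ?cross_ge0.
Qed.

Lemma le_comp_cross rho d x y c :
  (forall z, c <= cross d x z + cross rho z y) -> c <= comp_cross rho d x y.
Proof.
move=> H; apply: lb_le_inf; first by exists (cross d x x + cross rho x y); exists x.
by move=> _ [z _ <-].
Qed.

Lemma comp_cross_approx rho d x y e : 0 < e ->
  exists z, cross d x z + cross rho z y < comp_cross rho d x y + e.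
Proof.
move=> e0; apply: contrapT => /forallNP H.
suff : comp_cross rho d x y + e <= comp_cross rho d x y by lra.
by apply: le_comp_cross => z; rewrite leNgt; apply/negP; exact: H.
Qed.

Lemma comp_glueable rho d : glueable (comp_cross rho d).
Proof.
split.
- move=> x y z; rewrite -lerBlDl; apply: le_comp_cross => w.
  by have := comp_cross_le rho d x y w; have := cross_tril d x w z; lra.
- move=> x y z; rewrite -lerBlDr; apply: le_comp_cross => w.
  by have := comp_cross_le rho d x y w; have := cross_trir rho w y z; lra.
- move=> x y z; rewrite -lerBlDr; apply: le_comp_cross => w.
  rewrite lerBlDr addrC -lerBlDr; apply: le_comp_cross => v.
  have := cross_distl rho w v z; have := cross_distl d x y v.
  have := cross_trir d x v w.
  by lra.
- move=> x y z; rewrite -lerBlDr; apply: le_comp_cross => w.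
  rewrite lerBlDr addrC -lerBlDr; apply: le_comp_cross => v.
  have := cross_distr d w v z; have := cross_distr rho x y w.
  have := cross_tril rho w y v.
  by lra.
- have [c c0 cd] := cross_inf d; exists c => // x y.
  apply: le_comp_cross => z; rewrite -[c]addr0 lerD//.
  exact: cross_ge0.
Qed.

Definition comp rho d : double_metric X := glue (comp_glueable rho d).

Lemma unit_glueable : glueable (fun x y => mdist x y + 1).
Proof.
split=> [x y z|x y z|x y z|x y z|].
- by have := metric_triangle x z y; lra.
- by have := metric_triangle x z y; lra.
- by have := metric_triangle x z y; rewrite [mdist z y]metric_sym; lra.
- by have := metric_triangle x z y; rewrite [mdist x z]metric_sym; lra.
- by exists 1 => // x y; rewrite lerDr mdist_ge0.
Qed.

Definition unit_metric : double_metric X := glue unit_glueable.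

Lemma cone_glueable x0 : glueable (fun x y => mdist x x0 + 1 + mdist x0 y).
Proof.
split=> [x y z|x y z|x y z|x y z|].
- by have := metric_triangle x z x0; lra.
- by have := metric_triangle x0 z y; lra.
- have := metric_triangle x x0 y; rewrite [mdist x0 y]metric_sym.
  by have := mdist_ge0 x0 z; lra.
- have := metric_triangle x x0 y; rewrite [mdist x x0]metric_sym.
  by have := mdist_ge0 z x0; lra.
- by exists 1 => // x y; have := mdist_ge0 x x0; have := mdist_ge0 x0 y; lra.
Qed.

Definition cone_metric x0 : double_metric X := glue (cone_glueable x0).

(* On the empty space there is a single class, represented by unit_metric. *)
Definition zero_metric : double_metric X :=
  if pselect (exists x0 : X, True) is left h then cone_metric (projT1 (cid h))
  else unit_metric.

(* With f = min of the two diagonals, which is 2-Lipschitz, this metric satisfies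
   d(x, x') = f x (lemma min_diag); its class is the join. *)
Definition min_cross d rho x y : R :=
  inf [set mdist x z + Num.min (diag d z) (diag rho z) + mdist z y | z in [set: X]].

Lemma diag_lip d x y : diag d x <= 2 * mdist x y + diag d y.
Proof.
have := cross_tril d x x y; have := cross_trir d y x y.
by rewrite [mdist y x]metric_sym /diag; lra.
Qed.

Lemma min_ge0 d rho x : 0 <= Num.min (diag d x) (diag rho x).
Proof. by rewrite le_min !diag_ge0. Qed.

Lemma min_lip d rho x y :
  Num.min (diag d x) (diag rho x) <= 2 * mdist x y + Num.min (diag d y) (diag rho y).
Proof.
have := diag_lip d x y; have := diag_lip rho x y.
by rewrite ge_min; case: (leP (diag d y) (diag rho y)) => _; lra.
Qed.

Lemma min_cross_le d rho x y z :
  min_cross d rho x y <= mdist x z + Num.min (diag d z) (diag rho z) + mdist z y.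
Proof.
apply: ge_inf; last by exists z.
by exists 0 => _ [w _ <-]; rewrite !addr_ge0 ?mdist_ge0 ?min_ge0.
Qed.

Lemma le_min_cross d rho x y c :
  (forall z, c <= mdist x z + Num.min (diag d z) (diag rho z) + mdist z y) ->
  c <= min_cross d rho x y.
Proof.
move=> H; apply: lb_le_inf; first by eexists; exists x.
by move=> _ [z _ <-].
Qed.

Lemma min_cross_diag d rho x :
  min_cross d rho x x = Num.min (diag d x) (diag rho x).
Proof.
apply/eqP; rewrite eq_le; apply/andP; split.
  by have := min_cross_le d rho x x x; rewrite mdistxx; lra.
apply: le_min_cross => z.
by have := min_lip d rho x z; rewrite [mdist z x]metric_sym; lra.
Qed.

Lemma min_glueable d rho : glueable (min_cross d rho).
Proof.
have dist_le x y : mdist x y <= min_cross d rho x y.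
  apply: le_min_cross => z; have := metric_triangle x z y.
  by have := min_ge0 d rho z; lra.
split.
- move=> x y z; rewrite -lerBlDl; apply: le_min_cross => w.
  by have := min_cross_le d rho x y w; have := metric_triangle x z w; lra.
- move=> x y z; rewrite -lerBlDr; apply: le_min_cross => w.
  by have := min_cross_le d rho x y w; have := metric_triangle w z y; lra.
- move=> x y z; have := metric_triangle x z y; have := dist_le x z.
  by have := dist_le y z; rewrite [mdist z y]metric_sym; lra.
- move=> x y z; have := metric_triangle x z y; have := dist_le z x.
  by have := dist_le z y; rewrite [mdist x z]metric_sym; lra.
- have [c c0 cd] := cross_inf d; have [c' c'0 cr] := cross_inf rho.
  exists (Num.min c c'); first by rewrite lt_min c0.
  move=> x y; apply: le_min_cross => z.
  suff : Num.min c c' <= Num.min (diag d z) (diag rho z).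
    by have := mdist_ge0 x z; have := mdist_ge0 z y; lra.
  by rewrite le_min !ge_min cd cr orbT.
Qed.

Definition min_metric d rho : double_metric X := glue (min_glueable d rho).

Section Equivalence.
Context (k : equivalence_kind).

Definition dbl_equiv d rho : Prop :=
  fun_equiv k (fun p : X * X => cross d p.1 p.2) (fun p => cross rho p.1 p.2).

Definition cross_dom d rho : Prop :=
  dom k (fun p : X * X => cross d p.1 p.2) (fun p => cross rho p.1 p.2).

Lemma dbl_equivP d rho : dbl_equiv d rho <-> cross_dom d rho /\ cross_dom rho d.
Proof. by apply: fun_equivP => p; exact: cross_ge0. Qed.

Lemma cross_domP d rho : cross_dom d rho <->
  exists2 psi, bounding k psi & forall x y, cross d x y <= psi (cross rho x y).
Proof.
split=> -[psi bpsi H]; exists psi => //.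
by move=> x y; exact: (H (x, y)).
Qed.

Lemma cross_dom_refl d : cross_dom d d.
Proof. exact: domW. Qed.

Lemma cross_dom_trans rho d d' : cross_dom d rho -> cross_dom rho d' -> cross_dom d d'.
Proof. by apply: dom_trans => p; exact: cross_ge0. Qed.

Lemma dbl_equiv_class : equiv_class_of (fun d rho => `[< dbl_equiv d rho >]).
Proof.
split=> [d|d rho|rho d d'].
- by apply/asboolP/dbl_equivP; split; exact: cross_dom_refl.
- by apply/asboolP/asboolP => /dbl_equivP[? ?]; exact/dbl_equivP.
- move=> /asboolP/dbl_equivP[H1 H2] /asboolP/dbl_equivP[H3 H4].
  by apply/asboolP/dbl_equivP; split; apply: (@cross_dom_trans rho).
Qed.

Canonical dbl_equiv_rel := EquivRelPack dbl_equiv_class.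

Lemma comp_dom rho rho' d d' : cross_dom rho rho' -> cross_dom d d' ->
  cross_dom (comp rho d) (comp rho' d').
Proof.
move=> /cross_domP[psi bpsi H] /cross_domP[chi bchi H'].
apply/cross_domP; exists (fun t => chi (t + 1) + psi (t + 1)).
  by apply: bounding_add; exact: bounding_shift.
move=> x y; have [z hz] := comp_cross_approx rho' d' x y ltr01.
have h1 := cross_ge0 d' x z; have h2 := cross_ge0 rho' z y.
apply: (le_trans (comp_cross_le rho d x y z)).
have := H z y; have := H' x z; rewrite /cross /= -/(cross _ _ _).
have : psi (cross rho' z y) <= psi (comp_cross rho' d' x y + 1).
  by apply: (bounding_nd bpsi) => //; lra.
have : chi (cross d' x z) <= chi (comp_cross rho' d' x y + 1).
  by apply: (bounding_nd bchi) => //; lra.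
by rewrite /cross; lra.
Qed.

Definition idem_dom d : Prop :=
  exists2 psi, bounding k psi & forall x y, diag d x <= psi (cross d x y).

Lemma idem_domP d : dbl_equiv (comp d d) d <-> idem_dom d.
Proof.
split.
  move=> /dbl_equivP[/cross_domP[psi bpsi H] _].
  exists (fun t => 2 * (psi t + 1) + t).
    apply: bounding_add; last exact: bounding_id.
    have b1 : bounding k (fun t => psi t + 1).
      by apply: bounding_add => //; exact: bounding_cst.
    have -> : (fun t => 2 * (psi t + 1)) = (fun t => (psi t + 1) + (psi t + 1)).
      by apply/funext => t; lra.
    exact: bounding_add.
  move=> x y; have [z hz] := comp_cross_approx d d x y ltr01.
  have := H x y; rewrite {1}/cross /= => h.
  have := cross_distl d x z y; have := cross_trir d x x z.
  rewrite [mdist z x]metric_sym /diag.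
  have := cross_ge0 d x z; have := cross_ge0 d z y; lra.
move=> [psi bpsi H]; apply/dbl_equivP; split; apply/cross_domP.
  exists (fun t => psi t + t); first by apply: bounding_add => //; exact: bounding_id.
  move=> x y; rewrite {1}/cross /=; have := comp_cross_le d d x y x.
  by have := H x y; rewrite /diag; lra.
exists (fun t => (t + 1) + psi (t + 1)).
  by apply: bounding_add; [apply: (@bounding_shift _ _ id); exact: bounding_id|
    exact: bounding_shift].
move=> x y; have [z hz] := comp_cross_approx d d x y ltr01.
rewrite [cross (comp _ _) _ _]/cross /=.
have h1 := cross_ge0 d z y; have h2 := cross_ge0 d x z.
have : psi (cross d z y) <= psi (comp_cross d d x y + 1).
  by apply: (bounding_nd bpsi) => //; lra.
have := H z y; have := cross_tril d x y z; have := cross_distr d x z x.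
have := cross_distl d x z z; rewrite /diag.
by lra.
Qed.

Lemma idem_diag_dom d rho : idem_dom d -> idem_dom rho ->
  dom k (diag d) (diag rho) -> cross_dom d rho.
Proof.
move=> _ [psi bpsi H] [chi bchi H']; apply/cross_domP.
exists (fun t => chi (psi t) + (psi t + t)).
  apply: bounding_add; first exact: bounding_comp.
  by apply: bounding_add => //; exact: bounding_id.
move=> x y; have := H x y; have := cross_distr rho x y x.
have : chi (diag rho x) <= chi (psi (cross rho x y)).
  by apply: (bounding_nd bchi) => //; exact: diag_ge0.
have := H' x; have := cross_trir d x y x; rewrite /diag.
by lra.
Qed.

Lemma cross_dom_diag d rho : cross_dom d rho -> dom k (diag d) (diag rho).
Proof. by move=> /cross_domP[psi bpsi H]; exists psi => // x; exact: H. Qed.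

Lemma unit_idem : idem_dom unit_metric.
Proof.
exists id; first exact: bounding_id.
by move=> x y; rewrite /diag /cross/= mdistxx; have := mdist_ge0 x y; lra.
Qed.

Lemma cone_idem x0 : idem_dom (cone_metric x0).
Proof.
exists (fun t => t + t); first by apply: bounding_add; exact: bounding_id.
move=> x y; rewrite /diag /cross/= [mdist x0 x]metric_sym.
by have := mdist_ge0 x0 y; lra.
Qed.

Lemma zero_idem : idem_dom zero_metric.
Proof. by rewrite /zero_metric; case: pselect => h; [exact: cone_idem|exact: unit_idem]. Qed.

Lemma min_diag d rho : diag (min_metric d rho) = (fun x => Num.min (diag d x) (diag rho x)).
Proof. by apply/funext => x; exact: min_cross_diag. Qed.

Lemma min_idem d rho : idem_dom (min_metric d rho).
Proof.
exists (fun t => t + t); first by apply: bounding_add; exact: bounding_id.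
move=> x y; rewrite min_diag.
suff : 2^-1 * Num.min (diag d x) (diag rho x) <= cross (min_metric d rho) x y by lra.
apply: le_min_cross => z; have := min_lip d rho x z.
by have := mdist_ge0 z y; have := min_ge0 d rho z; lra.
Qed.

Lemma comp_bound rho d : idem_dom rho -> idem_dom d ->
  exists2 psi, bounding k psi &
    forall x y, diag d x + diag rho x <= psi (cross (comp rho d) x y).
Proof.
move=> [psi bpsi H] [chi bchi H'].
pose c t := chi (t + 1); pose p t := psi (t + 1).
have bc : bounding k c by exact: bounding_shift.
have bp : bounding k p by exact: bounding_shift.
have b1 : bounding k (fun t : R => t + 1) by apply: (@bounding_shift _ _ id); exact: bounding_id.
exists (fun t => (c t + (c t + c t)) + ((t + 1) + (t + 1) + p t)).
  apply: bounding_add; first by apply: bounding_add => //; exact: bounding_add.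
  by apply: bounding_add => //; exact: bounding_add.
move=> x y; have [z hz] := comp_cross_approx rho d x y ltr01.
rewrite [cross (comp _ _) _ _]/cross /= /c /p.
have h1 := cross_ge0 rho z y; have h2 := cross_ge0 d x z.
have : psi (cross rho z y) <= psi (comp_cross rho d x y + 1).
  by apply: (bounding_nd bpsi) => //; lra.
have : chi (cross d x z) <= chi (comp_cross rho d x y + 1).
  by apply: (bounding_nd bchi) => //; lra.
have := H z y; have := H' x z; have := cross_distr d x z x.
have := diag_lip rho x z; rewrite /diag.
by lra.
Qed.

Lemma comp_idem rho d : idem_dom rho -> idem_dom d -> idem_dom (comp rho d).
Proof.
move=> hr hd; have [psi bpsi H] := comp_bound hr hd.
exists psi => // x y; apply: le_trans (H x y).
exact: comp_cross_le.
Qed.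

Lemma comp_diag rho d : idem_dom rho -> idem_dom d ->
  sim k (diag (comp rho d)) (fun x => Num.max (diag rho x) (diag d x)).
Proof.
move=> hr hd; split.
- exact: diag_ge0.
- by move=> x; rewrite le_max diag_ge0.
- exists (fun t => t + t); first by apply: bounding_add; exact: bounding_id.
  move=> x; apply: (le_trans (comp_cross_le rho d x x x)).
  by rewrite addrC lerD// le_max lexx ?orbT.
- have [psi bpsi H] := comp_bound hr hd; exists psi => // x.
  apply: le_trans (H x x); have := diag_ge0 d x; have := diag_ge0 rho x.
  by rewrite ge_max; lra.
Qed.

Lemma zero_max d : dom k (diag d) (diag zero_metric).
Proof.
rewrite /zero_metric; case: pselect => [h|nh]; last first.
  by exists id; [exact: bounding_id|move=> x; case: nh; exists x].
set x0 := projT1 _.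
exists (fun t => diag d x0 + t).
  by apply: bounding_add; [apply: bounding_cst; exact: diag_ge0|exact: bounding_id].
move=> x; have := diag_lip d x x0.
by rewrite [diag (cone_metric _) _]/diag /cross /= [mdist x0 x]metric_sym; lra.
Qed.

Lemma unit_min d : dom k (diag unit_metric) (diag d).
Proof.
exists (fun t => 1 + t).
  by apply: bounding_add; [exact: bounding_cst|exact: bounding_id].
by move=> x; rewrite /diag /cross/= mdistxx; have := diag_ge0 d x; rewrite /diag/cross; lra.
Qed.

End Equivalence.
End DoubleMetrics.

(* M^q(X) is metric_class Quasi X and M^c(X) is metric_class Coarse X. *)
Definition metric_class (R : realType) (k : equivalence_kind) (X : metricType R) : Type :=
  {eq_quot dbl_equiv_rel (X := X) k}.

Section MetricClass.
Context {R : realType} {k : equivalence_kind} {X : metricType R}.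

HB.instance Definition _ := Choice.on (metric_class k X).
HB.instance Definition _ := EqQuotient.on (metric_class k X).

Implicit Types (d rho : double_metric X).

Definition class_of d : metric_class k X := \pi_(metric_class k X) d.

Lemma class_ofP d rho : class_of d = class_of rho <-> dbl_equiv k d rho.
Proof.
split=> [/eqP|h]; first by rewrite eqmodE => /asboolP.
by apply/eqP; rewrite eqmodE; exact/asboolP.
Qed.

(* [rho][d] = [rho d], see class_mulE *)
Definition class_mul (p q : metric_class k X) : metric_class k X :=
  class_of (comp (repr p) (repr q)).

Lemma class_repr (p : metric_class k X) : class_of (repr p) = p.
Proof. exact: reprK. Qed.

Lemma class_mulE rho d : class_mul (class_of rho) (class_of d) = class_of (comp rho d).
Proof.
apply/class_ofP/dbl_equivP.
have /class_ofP/dbl_equivP[h1 h2] := class_repr (class_of rho).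
have /class_ofP/dbl_equivP[h3 h4] := class_repr (class_of d).
by split; exact: comp_dom.
Qed.

Lemma class_idemP d :
  (class_mul (class_of d) (class_of d) == class_of d) <-> idem_dom k d.
Proof.
rewrite class_mulE; split=> [/eqP/class_ofP/idem_domP//|/idem_domP h].
exact/eqP/class_ofP.
Qed.

End MetricClass.

(* E(M(X)) *)
Definition idem_class (R : realType) (k : equivalence_kind) (X : metricType R) : Type :=
  {p : metric_class k X | class_mul p p == p}.

Fact idempotent_display : Order.disp_t. Proof. exact: Order.Disp tt tt. Qed.

Section Idempotent.
Context {R : realType} {k : equivalence_kind} {X : metricType R}.
Local Notation E := (idem_class k X).

HB.instance Definition _ := Choice.on E.

Implicit Types (p q : E) (d rho : double_metric X).

Definition idem_repr p : double_metric X := repr (val p).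

Lemma idem_repr_class p : class_of (idem_repr p) = val p.
Proof. exact: class_repr. Qed.

Lemma idem_repr_idem p : idem_dom k (idem_repr p).
Proof. by apply/class_idemP; rewrite idem_repr_class; exact: valP p. Qed.

Definition idem_of d (h : idem_dom k d) : E :=
  exist _ (class_of d) ((class_idemP d).2 h).

Lemma idem_of_repr d (h : idem_dom k d) :
  sim k (diag (idem_repr (idem_of h))) (diag d).
Proof.
have /class_ofP/dbl_equivP[h1 h2] := idem_repr_class (idem_of h).
by split; [exact: diag_ge0|exact: diag_ge0|exact: cross_dom_diag|exact: cross_dom_diag].
Qed.

Lemma idem_eqP p q f g : sim k (diag (idem_repr p)) f -> sim k (diag (idem_repr q)) g ->
  f =1 g -> p = q.
Proof.
move=> pf qg /funext fg; rewrite -{}fg in qg.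
have [_ _ h1 h2] := sim_trans pf (sim_sym qg).
apply/val_inj; rewrite -!idem_repr_class; apply/class_ofP/dbl_equivP.
by split; apply: idem_diag_dom => //; exact: idem_repr_idem.
Qed.

Definition idem_meet p q : E :=
  idem_of (comp_idem (idem_repr_idem p) (idem_repr_idem q)).

Definition idem_join p q : E :=
  idem_of (min_idem k (idem_repr p) (idem_repr q)).

(* The class of d_X(x, x0) + 1 + d_X(x0, y), see val_bottom *)
Definition idem_zero : E := idem_of (zero_idem k).
Definition idem_one : E := idem_of (unit_idem k).

Lemma meet_sim p q f g : sim k (diag (idem_repr p)) f -> sim k (diag (idem_repr q)) g ->
  sim k (diag (idem_repr (idem_meet p q))) (fun x => Num.max (f x) (g x)).
Proof.
move=> pf qg; apply: (sim_trans (idem_of_repr _)).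
apply: (sim_trans (comp_diag (idem_repr_idem p) (idem_repr_idem q))).
exact: sim_max.
Qed.

Lemma join_sim p q f g : sim k (diag (idem_repr p)) f -> sim k (diag (idem_repr q)) g ->
  sim k (diag (idem_repr (idem_join p q))) (fun x => Num.min (f x) (g x)).
Proof.
move=> pf qg; apply: (sim_trans (idem_of_repr _)).
by rewrite min_diag; exact: sim_min.
Qed.

Lemma repr_sim p : sim k (diag (idem_repr p)) (diag (idem_repr p)).
Proof. by apply: sim_refl; exact: diag_ge0. Qed.

Lemma idem_meetC : commutative idem_meet.
Proof.
move=> p q; apply: idem_eqP (meet_sim (repr_sim p) (repr_sim q))
  (meet_sim (repr_sim q) (repr_sim p)) _ => x.
exact: maxC.
Qed.

Lemma idem_joinC : commutative idem_join.
Proof.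
move=> p q; apply: idem_eqP (join_sim (repr_sim p) (repr_sim q))
  (join_sim (repr_sim q) (repr_sim p)) _ => x.
exact: minC.
Qed.

Lemma idem_meetA : associative idem_meet.
Proof.
move=> p q r; apply: idem_eqP
  (meet_sim (repr_sim p) (meet_sim (repr_sim q) (repr_sim r)))
  (meet_sim (meet_sim (repr_sim p) (repr_sim q)) (repr_sim r)) _ => x.
exact: maxA.
Qed.

Lemma idem_joinA : associative idem_join.
Proof.
move=> p q r; apply: idem_eqP
  (join_sim (repr_sim p) (join_sim (repr_sim q) (repr_sim r)))
  (join_sim (join_sim (repr_sim p) (repr_sim q)) (repr_sim r)) _ => x.
exact: minA.
Qed.

Lemma idem_joinKI q p : idem_meet p (idem_join p q) = p.
Proof.
apply: idem_eqP (meet_sim (repr_sim p) (join_sim (repr_sim p) (repr_sim q)))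
  (repr_sim p) _ => x.
exact: minKx.
Qed.

Lemma idem_meetKU q p : idem_join p (idem_meet p q) = p.
Proof.
apply: idem_eqP (join_sim (repr_sim p) (meet_sim (repr_sim p) (repr_sim q)))
  (repr_sim p) _ => x.
exact: maxKx.
Qed.

Lemma idem_meetUl : left_distributive idem_meet idem_join.
Proof.
move=> p q r; apply: idem_eqP
  (meet_sim (join_sim (repr_sim p) (repr_sim q)) (repr_sim r))
  (join_sim (meet_sim (repr_sim p) (repr_sim r)) (meet_sim (repr_sim q) (repr_sim r)))
  _ => x.
exact: max_minl.
Qed.

Lemma idem_meetxx : idempotent_op idem_meet.
Proof.
move=> p; apply: idem_eqP (meet_sim (repr_sim p) (repr_sim p)) (repr_sim p) _ => x.
exact: maxxx.
Qed.

HB.instance Definition _ := Order.isMeetJoinDistrLattice.Build idempotent_display E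
  (fun _ _ => erefl) (fun _ _ => erefl) idem_meetC idem_joinC idem_meetA idem_joinA
  idem_joinKI idem_meetKU idem_meetUl idem_meetxx.

Lemma idem_le_dom p q : dom k (diag (idem_repr q)) (diag (idem_repr p)) -> (p <= q)%O.
Proof.
move=> qp; apply/eqP.
apply: idem_eqP (meet_sim (repr_sim p) (repr_sim q)) _ (frefl _).
split; [exact: diag_ge0|by move=> x; rewrite le_max diag_ge0|
  by apply: domW => x; rewrite le_max lexx|].
have h : dom k (fun x => diag (idem_repr p) x + diag (idem_repr q) x) (diag (idem_repr p)).
  by apply: dom_add => //; exact: domW.
apply: dom_trans h; first by move=> x; rewrite addr_ge0 ?diag_ge0.
by apply: domW => x; rewrite ge_max lerDl lerDr !diag_ge0.
Qed.

Lemma idem_zero_le p : (idem_zero <= p)%O.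
Proof.
apply: idem_le_dom; have [_ _ _ h] := idem_of_repr (@zero_idem R X k).
by apply: dom_trans h; [exact: diag_ge0|exact: zero_max].
Qed.

Lemma idem_le_one p : (p <= idem_one)%O.
Proof.
apply: idem_le_dom; have [_ _ h _] := idem_of_repr (@unit_idem R X k).
by apply: dom_trans h _; [exact: diag_ge0|exact: unit_min].
Qed.

HB.instance Definition _ := Order.hasBottom.Build idempotent_display E idem_zero_le.
HB.instance Definition _ := Order.hasTop.Build idempotent_display E idem_le_one.

(* The lattice operations are those of the classes of the functions
   x |-> d(x, x'), and do not depend on the representatives. *)

Lemma idem_class_funP d rho : idem_dom k d -> idem_dom k rho ->
  class_of d = class_of rho :> metric_class k X <-> fun_equiv k (diag d) (diag rho).
Proof.
move=> hd hr; rewrite (fun_equivP k (diag_ge0 d) (diag_ge0 rho)); split.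
  by move=> /class_ofP/dbl_equivP[h1 h2]; split; exact: cross_dom_diag.
by move=> [h1 h2]; apply/class_ofP/dbl_equivP; split; exact: idem_diag_dom.
Qed.

Lemma val_meet p q : val (p `&` q)%O = class_mul (val p) (val q).
Proof. by []. Qed.

Lemma class_diag p d : class_of d = val p -> sim k (diag (idem_repr p)) (diag d).
Proof.
rewrite -idem_repr_class => /class_ofP/dbl_equivP[h1 h2].
by split; [exact: diag_ge0|exact: diag_ge0|exact: cross_dom_diag|exact: cross_dom_diag].
Qed.

Lemma sim_fun_equiv (f g : X -> R) : sim k f g -> fun_equiv k f g.
Proof. by case=> f0 g0 h1 h2; apply/fun_equivP. Qed.

Lemma diag_meet p q d1 d2 d : class_of d1 = val p -> class_of d2 = val q ->
  class_of d = val (p `&` q)%O ->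
  fun_equiv k (diag d) (fun x => Num.max (diag d1 x) (diag d2 x)).
Proof.
move=> /class_diag h1 /class_diag h2 /class_diag h.
by apply/sim_fun_equiv/(sim_trans (sim_sym h)); exact: meet_sim.
Qed.

Lemma diag_join p q d1 d2 d : class_of d1 = val p -> class_of d2 = val q ->
  class_of d = val (p `|` q)%O ->
  fun_equiv k (diag d) (fun x => Num.min (diag d1 x) (diag d2 x)).
Proof.
move=> /class_diag h1 /class_diag h2 /class_diag h.
by apply/sim_fun_equiv/(sim_trans (sim_sym h)); exact: join_sim.
Qed.

Lemma val_bottom x0 : val (\bot%O : E) = class_of (cone_metric x0).
Proof.
have /class_diag [_ _ _ h] := erefl (val (\bot%O : E)) : class_of zero_metric = _.
apply/idem_class_funP; [exact: zero_idem|exact: cone_idem|].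
apply/fun_equivP; [exact: diag_ge0|exact: diag_ge0|split; last exact: zero_max].
rewrite /zero_metric; case: pselect => [h'|[]]; last by exists x0.
exists (fun t => (2 * mdist (projT1 (cid h')) x0 + diag (cone_metric (projT1 (cid h'))) x0) + t).
  apply: bounding_add; last exact: bounding_id.
  by apply: bounding_cst; rewrite addr_ge0 ?mulr_ge0 ?mdist_ge0 ?diag_ge0.
move=> x; set y0 := projT1 _.
have := diag_lip (cone_metric y0) x x0; have := mdist_ge0 y0 x0.
by rewrite [diag (cone_metric x0) x]/diag /cross/= [mdist x0 x]metric_sym; lra.
Qed.

Lemma val_top : val (\top%O : E) = class_of unit_metric.
Proof. by []. Qed.

End Idempotent.

(* A formal sum mod 2 of nonzero elements is the finite set of its terms, and
   addition is symmetric difference. *)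
Definition nonzero (disp : Order.disp_t) (E : tbDistrLatticeType disp) : Type :=
  {e : E | (e != \bot)%O}.

HB.instance Definition _ (disp : Order.disp_t) (E : tbDistrLatticeType disp) :=
  SubChoice.on (nonzero E).

Definition formal_sum (disp : Order.disp_t) (E : tbDistrLatticeType disp) : Type :=
  {fset nonzero E}.

HB.instance Definition _ (disp : Order.disp_t) (E : tbDistrLatticeType disp) :=
  Choice.on (formal_sum E).

Section FormalSum.
Context {disp : Order.disp_t} {E : tbDistrLatticeType disp}.
Local Notation H := (formal_sum E).
Implicit Types (s t u : H) (e f : E).

Definition fsum_zero : H := fset0.

Definition fsum_add s t : H := ((s `\` t) `|` (t `\` s))%fset.

Lemma in_fsum_add s t a : a \in (fsum_add s t : {fset _}) =
  (a \in (s : {fset _})) (+) (a \in (t : {fset _})).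
Proof. by rewrite !inE; case: (_ \in _); case: (_ \in _). Qed.

Lemma fsum_addA : associative fsum_add.
Proof. by move=> s t u; apply/fsetP => a; rewrite !in_fsum_add addbA. Qed.

Lemma fsum_addC : commutative fsum_add.
Proof. by move=> s t; apply/fsetP => a; rewrite !in_fsum_add addbC. Qed.

Lemma fsum_add0 : left_id fsum_zero fsum_add.
Proof. by move=> s; apply/fsetP => a; rewrite !in_fsum_add in_fset0. Qed.

Lemma fsum_addN : left_inverse fsum_zero id fsum_add.
Proof. by move=> s; apply/fsetP => a; rewrite !in_fsum_add in_fset0 addbb. Qed.

HB.instance Definition _ :=
  GRing.isZmodule.Build H fsum_addA fsum_addC fsum_add0 fsum_addN.

Lemma fsum_addss s : s + s = 0. Proof. exact: fsum_addN. Qed.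

(* The sum with the single term e, or the empty sum if e is the bottom *)
Definition term e : H := if insub e is Some a then [fset a]%fset else fset0.

Lemma term0 : term \bot%O = 0.
Proof. by rewrite /term insubN// negbK. Qed.

Lemma term_val (a : nonzero E) : term (val a) = [fset a]%fset.
Proof. by rewrite /term valK. Qed.

Lemma big_fsum_add (V : zmodType) (F : nonzero E -> V) s t :
  (forall v : V, v + v = 0) ->
  \sum_(a <- (s + t : H)) F a = \sum_(a <- s) F a + \sum_(a <- t) F a.
Proof.
move=> VV.
rewrite (big_fsetID _ (mem (t : {fset _})) s) (big_fsetID _ (mem (s : {fset _})) t) /=.
rewrite (big_fsetID _ (mem (s : {fset _})) (s + t : H)) /=.
have -> : [fset x | x in (s : {fset _}) & x \in (t : {fset _})]%fset
  = [fset x | x in (t : {fset _}) & x \in (s : {fset _})]%fset.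
  by apply/fsetP => a; rewrite !inE andbC.
rewrite addrACA VV add0r; congr (_ + _); congr (\sum_(a <- _) F a).
  apply: congr1; apply/fsetP => a; rewrite !inE.
  by case: (a \in s); case: (a \in t).
apply: congr1; apply/fsetP => a; rewrite !inE.
by case: (a \in s); case: (a \in t).
Qed.

Lemma fsumE s : s = \sum_(a <- s) term (val a).
Proof.
elim/finSet_rect: s => s IH.
have [->|[a as_]] := fset_0Vmem s; first by rewrite big_nil.
rewrite (big_fsetD1 a)//= term_val -IH; last first.
  by rewrite -[X in (X `<` _)%fset]/(s `\ a)%fset fproperD1.
apply/fsetP => b; rewrite in_fsum_add !inE.
by case: eqVneq => [->|] //=; rewrite as_.
Qed.

Definition fsum_mul s t : H :=
  \sum_(a <- s) \sum_(b <- t) term (val a `&` val b)%O.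

Lemma fsum_mulC : commutative fsum_mul.
Proof.
move=> s t; rewrite /fsum_mul exchange_big /=.
by apply: eq_bigr => b _; apply: eq_bigr => a _; rewrite meetC.
Qed.

Lemma fsum_mulDl : left_distributive fsum_mul +%R.
Proof. by move=> s t u; rewrite /fsum_mul big_fsum_add//; exact: fsum_addss. Qed.

Lemma fsum_mul0 s : fsum_mul 0 s = 0.
Proof. by rewrite /fsum_mul big_nil. Qed.

Lemma fsum_mul_suml (I : Type) (r : seq I) (F : I -> H) t :
  fsum_mul (\sum_(i <- r) F i) t = \sum_(i <- r) fsum_mul (F i) t.
Proof.
by apply: (big_morph (fsum_mul^~ t)) => [s u|]; rewrite ?fsum_mulDl ?fsum_mul0.
Qed.

Lemma fsum_mul_terml e t : fsum_mul (term e) t = \sum_(b <- t) term (e `&` val b)%O.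
Proof.
have [->|e0] := eqVneq e \bot%O.
  by rewrite term0 fsum_mul0 big1// => b _; rewrite meet0x term0.
pose a : nonzero E := exist _ e e0.
by rewrite -[e]/(val a) term_val /fsum_mul big_seq_fset1.
Qed.

Lemma fsum_mul1 : left_id (term \top%O) fsum_mul.
Proof.
move=> s; rewrite fsum_mul_terml [RHS]fsumE.
by apply: eq_bigr => a _; rewrite meet1x.
Qed.

Lemma fsum_mul_term e f : fsum_mul (term e) (term f) = term (e `&` f)%O.
Proof.
have [->|f0] := eqVneq f \bot%O.
  by rewrite term0 fsum_mulC fsum_mul0 meetx0 term0.
pose a : nonzero E := exist _ f f0.
by rewrite fsum_mul_terml -[f]/(val a) term_val big_seq_fset1.
Qed.

Lemma fsum_ind (P : H -> Prop) : P 0 -> (forall s t, P s -> P t -> P (s + t)) ->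
  (forall e, P (term e)) -> forall s, P s.
Proof. by move=> P0 PD Pt s; rewrite (fsumE s); apply: big_ind => // a _; exact: Pt. Qed.

Lemma fsum_mulDr : right_distributive fsum_mul +%R.
Proof. by move=> s t u; rewrite fsum_mulC fsum_mulDl ![fsum_mul _ s]fsum_mulC. Qed.

Lemma fsum_mulA : associative fsum_mul.
Proof.
have m0 s : fsum_mul s 0 = 0 by rewrite fsum_mulC fsum_mul0.
move=> s t u; elim/fsum_ind: s => [|s s' IH IH'|e]; first by rewrite !fsum_mul0.
  by rewrite !fsum_mulDl IH IH'.
elim/fsum_ind: t => [|t t' IH IH'|f]; first by rewrite !(fsum_mul0, m0).
  by rewrite !(fsum_mulDl, fsum_mulDr) IH IH'.
elim/fsum_ind: u => [|u u' IH IH'|g]; first by rewrite !m0.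
  by rewrite !fsum_mulDr IH IH'.
by rewrite !fsum_mul_term meetA.
Qed.

HB.instance Definition _ :=
  GRing.Zmodule_isComPzRing.Build H fsum_mulA fsum_mulC fsum_mul1 fsum_mulDl.

Lemma fsum_mulss s : s * s = s.
Proof.
elim/fsum_ind: s => [|s t IH IH'|e]; first by rewrite mul0r.
  by rewrite mulrDl !mulrDr IH IH' addrACA [t * s]mulrC addrA -[s + _ + _]addrA fsum_addss addr0.
by rewrite [LHS]fsum_mul_term meetxx.
Qed.

End FormalSum.

Definition ideal_closed (R : comPzRingType) (J : set R) : Prop :=
  [/\ J 0, forall a b, J a -> J b -> J (a + b) & forall c a, J a -> J (c * a)].

Section LatticeIdeal.
Context {disp : Order.disp_t} (E : tbDistrLatticeType disp).
Local Notation H := (formal_sum E).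

Definition lattice_relations : set H :=
  [set term p.1 + term p.2 + term (p.1 `&` p.2)%O + term (p.1 `|` p.2)%O | p in [set: E * E]].

Definition lattice_ideal_set : set H :=
  smallest (@ideal_closed H) lattice_relations.

Definition lattice_ideal : {pred H} := fun s => `[< lattice_ideal_set s >].

Lemma lattice_idealP : ideal_closed lattice_ideal_set.
Proof.
split=> [J [[]]//|a b Ja Jb J JJ|c a Ja J JJ].
  by have [[_ + _] _] := JJ; apply; [exact: Ja|exact: Jb].
by have [[_ _ +] _] := JJ; apply; exact: Ja.
Qed.

Lemma lattice_idealMl (c a : H) : a \in lattice_ideal -> c * a \in lattice_ideal.
Proof.
move=> /asboolP Ja; apply/asboolP.
by have [_ _ +] := lattice_idealP; apply.
Qed.

Lemma lattice_ideal_zmod : zmod_closed lattice_ideal.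
Proof.
have [J0 JD JM] := lattice_idealP.
split=> [|a b /asboolP Ja /asboolP Jb]; first exact/asboolP.
apply/asboolP; apply: (JD a (- b)) => //; rewrite -mulN1r; exact: JM.
Qed.

HB.instance Definition _ := GRing.isZmodClosed.Build H lattice_ideal lattice_ideal_zmod.

End LatticeIdeal.

Arguments lattice_ideal {disp} E _ : rename.

(* L = H / I; the library's ring quotient requires a proper ideal, which I need
   not be, so only its quotient of additive groups is reused. *)
Definition boolean_envelope (disp : Order.disp_t) (E : tbDistrLatticeType disp) : Type :=
  Quotient.quot (lattice_ideal E : zmodClosed (formal_sum E)).

Fact boolean_display : Order.disp_t. Proof. exact: Order.Disp tt tt. Qed.

Section BooleanEnvelope.
Context {disp : Order.disp_t} {E : tbDistrLatticeType disp}.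
Local Notation H := (formal_sum E).
Local Notation L := (boolean_envelope E).

HB.instance Definition _ := GRing.Zmodule.on L.
HB.instance Definition _ := EqQuotient.on L.

Definition quo (s : H) : L := \pi_L s.

Lemma quoP s t : quo s = quo t <-> s - t \in lattice_ideal E.
Proof. by rewrite Quotient.idealrBE; split=> [/eqP|/eqP]. Qed.

Lemma quo_repr (a : L) : quo (repr a) = a. Proof. exact: reprK. Qed.

Lemma quoD s t : quo (s + t) = quo s + quo t.
Proof. exact: Quotient.pi_add. Qed.

Lemma quo0 : quo 0 = 0. Proof. by rewrite /quo piE. Qed.

Definition env_mul (a b : L) : L := quo (repr a * repr b).

Lemma quoM s t : quo (s * t) = env_mul (quo s) (quo t).
Proof.
apply/quoP; set s' := repr _; set t' := repr _.
have hs : s - s' \in lattice_ideal E by apply/quoP; rewrite quo_repr.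
have ht : t - t' \in lattice_ideal E by apply/quoP; rewrite quo_repr.
have -> : s * t - s' * t' = t * (s - s') + s' * (t - t').
  by rewrite !mulrBr addrA [s' * t]mulrC [s * t]mulrC [t * s' ]mulrC subrK.
by rewrite rpredD// lattice_idealMl.
Qed.

Lemma env_mulA : associative env_mul.
Proof.
by move=> a b c; rewrite -(quo_repr a) -(quo_repr b) -(quo_repr c) -!quoM mulrA.
Qed.

Lemma env_mulC : commutative env_mul.
Proof. by move=> a b; rewrite /env_mul mulrC. Qed.

Lemma env_mul1 : left_id (quo 1) env_mul.
Proof. by move=> a; rewrite -(quo_repr a) -quoM mul1r. Qed.

Lemma env_mulDl : left_distributive env_mul +%R.
Proof.
move=> a b c; rewrite -(quo_repr a) -(quo_repr b) -(quo_repr c).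
by rewrite -quoD -!quoM -quoD mulrDl.
Qed.

HB.instance Definition _ :=
  GRing.Zmodule_isComPzRing.Build L env_mulA env_mulC env_mul1 env_mulDl.

Lemma env_mulaa (a : L) : a * a = a.
Proof. by rewrite -(quo_repr a) -[LHS]quoM fsum_mulss. Qed.

Lemma env_addaa (a : L) : a + a = 0.
Proof. by rewrite -(quo_repr a) -quoD fsum_addss quo0. Qed.

Definition env_join (a b : L) : L := a + b + a * b.
Definition env_compl (a : L) : L := 1 + a.

Lemma env_joinC : commutative env_join.
Proof. by move=> a b; rewrite /env_join [a + b]addrC [a * b]mulrC. Qed.

Lemma env_joinE (a b : L) : env_join a b = 1 + (1 + a) * (1 + b).
Proof.
rewrite /env_join mulrDl mul1r mulrDr mulr1 -!addrA [RHS]addrA env_addaa add0r.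
exact: addrCA.
Qed.

Lemma env_joinA : associative env_join.
Proof.
have K (a : L) : 1 + (1 + a) = a by rewrite addrA env_addaa add0r.
by move=> a b c; rewrite !env_joinE !K mulrA.
Qed.

Lemma env_joinKI (b a : L) : a * env_join a b = a.
Proof.
by rewrite /env_join !mulrDr mulrA !env_mulaa -addrA env_addaa addr0.
Qed.

Lemma env_meetKU (b a : L) : env_join a (a * b) = a.
Proof. by rewrite /env_join mulrA env_mulaa -addrA env_addaa addr0. Qed.

Lemma env_meetUl : left_distributive ( *%R : L -> L -> L) env_join.
Proof.
move=> a b c; rewrite /env_join !mulrDl; congr (_ + _).
by rewrite mulrACA env_mulaa.
Qed.

HB.instance Definition _ := Order.isMeetJoinDistrLattice.Build boolean_display L
  (fun _ _ => erefl) (fun _ _ => erefl) env_mulC env_joinC env_mulA env_joinA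
  env_joinKI env_meetKU env_meetUl env_mulaa.

Lemma env_0le (a : L) : (0 <= a :> L)%O.
Proof. by apply/eqP; exact: mul0r. Qed.

Lemma env_le1 (a : L) : (a <= 1 :> L)%O.
Proof. by apply/eqP; exact: mulr1. Qed.

HB.instance Definition _ := Order.hasBottom.Build boolean_display L env_0le.
HB.instance Definition _ := Order.hasTop.Build boolean_display L env_le1.

Lemma env_joinxC (a : L) : (a `|` env_compl a = \top)%O.
Proof.
rewrite -[LHS]/(a + (1 + a) + a * (1 + a)) mulrDr mulr1 env_mulaa env_addaa addr0.
by rewrite addrCA env_addaa addr0.
Qed.

Lemma env_meetxC (a : L) : (a `&` env_compl a = \bot)%O.
Proof. by rewrite -[LHS]/(a * (1 + a)) mulrDr mulr1 env_mulaa env_addaa. Qed.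

HB.instance Definition _ :=
  Order.TBDistrLattice_hasComplement.Build boolean_display L env_joinxC env_meetxC.

Lemma env_meetE (a b : L) : (a `&` b)%O = a * b. Proof. by []. Qed.
Lemma env_complE (a : L) : (~` a)%O = 1 + a. Proof. by []. Qed.

(* The inclusion of E in L *)
Definition lattice_incl (e : E) : L := quo (term e).

Lemma inclI (e f : E) : lattice_incl (e `&` f)%O = (lattice_incl e `&` lattice_incl f)%O.
Proof. by rewrite env_meetE /lattice_incl -fsum_mul_term; exact: quoM. Qed.

Lemma incl_relation (e f : E) :
  lattice_incl e + lattice_incl f + lattice_incl (e `&` f)%O + lattice_incl (e `|` f)%O = 0.
Proof.
rewrite -!quoD -quo0; apply/quoP; rewrite subr0; apply/asboolP.
by move=> J [_]; apply; exists (e, f).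
Qed.

Lemma inclU (e f : E) : lattice_incl (e `|` f)%O = (lattice_incl e `|` lattice_incl f)%O.
Proof.
rewrite -[RHS]/(lattice_incl e + lattice_incl f + lattice_incl e * lattice_incl f) -env_meetE -inclI.
apply: (addrI (lattice_incl e + lattice_incl f + lattice_incl (e `&` f)%O)).
by rewrite incl_relation env_addaa.
Qed.

Lemma incl0 : lattice_incl \bot%O = \bot%O.
Proof. by rewrite /lattice_incl term0 quo0. Qed.

Lemma incl1 : lattice_incl \top%O = \top%O. Proof. by []. Qed.

End BooleanEnvelope.

(* The two-element Boolean algebra is bool. *)

Definition unital_lattice_hom (disp : Order.disp_t) (E : tbDistrLatticeType disp)
    (f : E -> bool) : Prop :=
  [/\ Order.meet_morphism f, Order.join_morphism f,
      f \bot%O = \bot%O & f \top%O = \top%O].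

Definition boolean_hom (disp : Order.disp_t) (B : ctbDistrLatticeType disp)
    (f : B -> bool) : Prop :=
  unital_lattice_hom f /\ forall b, f (~` b)%O = (~` f b)%O.

(* Main.v *)
Require Import Defs.
From mathcomp Require Import all_boot all_order all_algebra.
From mathcomp Require Import all_classical all_reals all_analysis.
From mathcomp Require finmap.

(** The statement is lattice theory: it holds for every bounded distributive
    lattice E, with L the Boolean ring H / I generated by E.

    Uniqueness of extensions: addition in L is symmetric difference, that is,
    a + b is the complement of the meet of a and b in their join, so every
    Boolean homomorphism L -> Z/2 is additive ([boolean_homD]).  As L is additively
    generated by the image of E ([envelope_ind]), such a homomorphism is
    determined by its restriction to E.

    Existence of extensions: a lattice homomorphism phi : E -> Z/2 extends
    linearly to a map H -> Z/2 ([fsum_eval]), which is a ring homomorphism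
    because phi turns meets into products.  In Z/2 one has
    a + b + ab + (a `|` b) = 0, so the generators of I are sent to 0, hence so
    is I ([fsum_eval_ideal]), and the map descends to L ([envelope_ext]).
    A unital ring homomorphism between Boolean rings preserves the Boolean
    operations, because these are polynomials in + and *. *)

Import GRing.Theory.

Local Open Scope classical_set_scope.

Lemma envelope_ind (disp : Order.disp_t) (E : tbDistrLatticeType disp)
    (P : boolean_envelope E -> Prop) :
  P 0%R -> (forall a b, P a -> P b -> P (a + b)%R) ->
  (forall e, P (lattice_incl e)) -> forall a, P a.
Proof.
move=> P0 PD Pe a; rewrite -(quo_repr a).
elim/(@fsum_ind disp E): (repr a) => [|s t Ps Pt|e]; first by rewrite quo0.
  by rewrite quoD; exact: PD.
exact: Pe.
Qed.

(** In a Boolean ring, ab and a + b are disjoint and their join is a `|` b, so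
    psi (a + b) is the complement of psi a && psi b in psi a || psi b. *)
Lemma boolean_homD (disp : Order.disp_t) (E : tbDistrLatticeType disp)
    (psi : boolean_envelope E -> bool) (a b : boolean_envelope E) :
  boolean_hom psi -> psi (a + b)%R = psi a (+) psi b.
Proof.
move=> [[psiI psiU psi0 _] _].
have abI : (a * b * (a + b) = 0)%R.
  by rewrite mulrDr mulrAC env_mulaa -mulrA env_mulaa env_addaa.
have := psiU (a * b)%R (a + b)%R.
rewrite -[(_ `|` _)%O]/(a * b + (a + b) + a * b * (a + b))%R abI addr0.
rewrite addrC -[(a + b + a * b)%R]/(a `|` b)%O psiU.
have := psiI (a * b)%R (a + b)%R.
rewrite -[(_ `&` _)%O]/(a * b * (a + b))%R abI psi0.
rewrite -[(a * b)%R]/(a `&` b)%O psiI.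
by case: (psi a); case: (psi b); case: (psi _).
Qed.

(** The sum is taken in bool as the field of two elements, where addition is
    exclusive or. *)
Definition fsum_eval {disp : Order.disp_t} {E : tbDistrLatticeType disp}
    (phi : E -> bool) (s : formal_sum E) : bool :=
  (\sum_(a <- finmap.enum_fset s) phi (\val a))%R.

Lemma fsum_evalD (disp : Order.disp_t) (E : tbDistrLatticeType disp)
    (phi : E -> bool) (s t : formal_sum E) :
  fsum_eval phi (s + t)%R = (fsum_eval phi s + fsum_eval phi t)%R.
Proof. by apply: big_fsum_add => -[]. Qed.

Lemma fsum_eval0 (disp : Order.disp_t) (E : tbDistrLatticeType disp)
    (phi : E -> bool) : fsum_eval phi 0%R = 0%R.
Proof. exact: big_nil. Qed.

Lemma fsum_eval_term (disp : Order.disp_t) (E : tbDistrLatticeType disp)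
    (phi : E -> bool) (e : E) :
  phi \bot%O = false -> fsum_eval phi (term e) = phi e.
Proof.
move=> phi0; have [->|e0] := eqVneq e \bot%O.
  by rewrite term0 fsum_eval0 phi0.
pose a : nonzero E := exist _ e e0.
by rewrite -[e]/(val a) term_val /fsum_eval finmap.big_seq_fset1.
Qed.

Lemma fsum_evalM (disp : Order.disp_t) (E : tbDistrLatticeType disp)
    (phi : E -> bool) (s t : formal_sum E) :
  unital_lattice_hom phi ->
  fsum_eval phi (s * t)%R = (fsum_eval phi s * fsum_eval phi t)%R.
Proof.
move=> [phiI _ phi0 _].
elim/(@fsum_ind disp E): s => [|s s' IH IH'|e]; first by rewrite mul0r !fsum_eval0 mul0r.
  by rewrite mulrDl !fsum_evalD IH IH' mulrDl.
elim/(@fsum_ind disp E): t => [|t t' IH IH'|f]; first by rewrite mulr0 !fsum_eval0 mulr0.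
  by rewrite mulrDr !fsum_evalD IH IH' mulrDr.
by rewrite -[(term e * term f)%R]/(fsum_mul _ _) fsum_mul_term !fsum_eval_term.
Qed.

(** The kernel of the linear extension is an ideal, and it contains the
    generators of I because a + b + ab + (a `|` b) = 0 in Z/2. *)
Lemma fsum_eval_ideal (disp : Order.disp_t) (E : tbDistrLatticeType disp)
    (phi : E -> bool) (s : formal_sum E) :
  unital_lattice_hom phi -> s \in lattice_ideal E -> fsum_eval phi s = 0%R.
Proof.
move=> hphi /asboolP; move: s.
apply: (@smallest_sub _ _ _ [set s | fsum_eval phi s = 0%R]) => [|_ [[e f] _ <-]] /=.
  split=> [|s t /= s0 t0|c s /= s0]; first exact: fsum_eval0.
    by rewrite fsum_evalD s0 t0.
  by rewrite fsum_evalM// s0 mulr0.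
have [phiI phiU phi0 _] := hphi.
rewrite !fsum_evalD !fsum_eval_term// phiI phiU.
by case: (phi e); case: (phi f).
Qed.

Definition envelope_ext {disp : Order.disp_t} {E : tbDistrLatticeType disp}
    (phi : E -> bool) (a : boolean_envelope E) : bool :=
  fsum_eval phi (repr a).

(** Two representatives of a class differ by an element of I, on which the
    linear extension vanishes. *)
Lemma envelope_ext_quo (disp : Order.disp_t) (E : tbDistrLatticeType disp)
    (phi : E -> bool) (s : formal_sum E) :
  unital_lattice_hom phi -> envelope_ext phi (quo s) = fsum_eval phi s.
Proof.
move=> hphi; rewrite -[in RHS](subrK (repr (quo s)) s) fsum_evalD.
by rewrite (@fsum_eval_ideal _ _ _ (s - _)%R)// ?add0r//; apply/quoP; rewrite quo_repr.
Qed.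

Lemma envelope_ext_incl (disp : Order.disp_t) (E : tbDistrLatticeType disp)
    (phi : E -> bool) (e : E) :
  unital_lattice_hom phi -> envelope_ext phi (lattice_incl e) = phi e.
Proof. by move=> hphi; rewrite envelope_ext_quo// fsum_eval_term//; case: hphi. Qed.

Lemma envelope_ext_boolean_hom (disp : Order.disp_t)
    (E : tbDistrLatticeType disp) (phi : E -> bool) :
  unital_lattice_hom phi -> boolean_hom (envelope_ext phi).
Proof.
move=> hphi; have [_ _ phi0 phi1] := hphi.
have extD a b : envelope_ext phi (a + b)%R = envelope_ext phi a (+) envelope_ext phi b.
  by rewrite -(quo_repr a) -(quo_repr b) -quoD !envelope_ext_quo ?fsum_evalD.
have extM a b : envelope_ext phi (a * b)%R = envelope_ext phi a && envelope_ext phi b.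
  rewrite -(quo_repr a) -(quo_repr b) -[(quo _ * quo _)%R]quoM.
  by rewrite !envelope_ext_quo ?fsum_evalM.
have ext0 : envelope_ext phi \bot%O = false by rewrite -incl0 envelope_ext_incl.
have ext1 : envelope_ext phi \top%O = true by rewrite -incl1 envelope_ext_incl.
split; first split=> // a b.
  rewrite -[(a `|` b)%O]/(a + b + a * b)%R !extD extM.
  by case: (envelope_ext phi a); case: (envelope_ext phi b).
by move=> b; rewrite env_complE extD ext1.
Qed.

Lemma boolean_hom_restrict (disp : Order.disp_t) (E : tbDistrLatticeType disp)
    (psi : boolean_envelope E -> bool) :
  boolean_hom psi -> unital_lattice_hom (psi \o lattice_incl).
Proof.
move=> [[psiI psiU psi0 psi1] _]; split=> [e f|e f||] /=.
- by rewrite inclI psiI.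
- by rewrite inclU psiU.
- by rewrite incl0.
- by rewrite incl1.
Qed.

Lemma boolean_hom_ext_unique (disp : Order.disp_t) (E : tbDistrLatticeType disp)
    (psi chi : boolean_envelope E -> bool) :
  boolean_hom psi -> boolean_hom chi ->
  psi \o lattice_incl = chi \o lattice_incl -> psi = chi.
Proof.
move=> hpsi hchi eq_incl; apply/funext.
apply: envelope_ind => [|a b eqa eqb|e]; last exact: (congr1 (fun f => f e) eq_incl).
  by have [[_ _ psi0 _] _] := hpsi; have [[_ _ chi0 _] _] := hchi; rewrite psi0.
by rewrite !boolean_homD// eqa eqb.
Qed.

Theorem proposition6p1 (R : realType) (X : metricType R) (k : equivalence_kind) :
  set_bij
    [set psi : boolean_envelope (idem_class k X) -> bool | boolean_hom psi]
    [set phi : idem_class k X -> bool | unital_lattice_hom phi]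
    (fun psi => psi \o lattice_incl).
Proof.
split.
- move=> psi; exact: boolean_hom_restrict.
- by move=> psi chi /set_mem hpsi /set_mem hchi; exact: boolean_hom_ext_unique.
- move=> phi hphi; exists (envelope_ext phi); first exact: envelope_ext_boolean_hom.
  by apply/funext => e; exact: envelope_ext_incl.
Qed.
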